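(* Let $G$ be a finite group and let $r=\mathrm{rk}\big(G'/(G'\cap \mathbf{Z}(G))\big)$. Then $|G:\mathbf{Z}_2(G)|\leq |G'/(G'\cap \mathbf{Z}(G))|^{4r}$.
   Context: $G'$ is the derived (commutator) subgroup of $G$ and $\mathbf{Z}(G)$ its centre. $\mathbf{Z}_2(G)$ is the second member of the upper central series of $G$, i.e. $\mathbf{Z}_2(G)/\mathbf{Z}(G)=\mathbf{Z}(G/\mathbf{Z}(G))$. The rank $\mathrm{rk}(H)$ of a finite group $H$ is the minimal number $r$ such that every subgroup of $H$ can be generated by $r$ elements. *)

(* Defs.v *)
From mathcomp Require Import all_boot all_fingroup all_solvable.

Set Implicit Arguments.
Unset Strict Implicit.
Unset Printing Implicit Defensive.

Local Open Scope group_scope.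

Definition generated_by (gT : finGroupType) (K : {group gT}) (r : nat) : bool :=
  [exists A : {set gT}, (#|A| <= r) && (<<A>> == K :> {set gT})].

Definition subgroups_generated_by
    (gT : finGroupType) (H : {group gT}) (r : nat) : bool :=
  [forall K : {group gT}, (K \subset H) ==> generated_by K r].

Lemma ex_subgroups_generated_by (gT : finGroupType) (H : {group gT}) :
  exists r, subgroups_generated_by H r.
Proof.
exists #|H|; apply/forallP=> K; apply/implyP=> sKH.
by apply/existsP; exists (K : {set gT}); rewrite subset_leq_card //= genGid.
Qed.

(* Not MathComp's ['r(H)], which is the maximal rank of an elementary abelian
   p-subgroup of H. *)
Definition rk (gT : finGroupType) (H : {group gT}) : nat :=
  ex_minn (ex_subgroups_generated_by H).

(* Main.v *)
Require Import Defs.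
From mathcomp Require Import all_boot all_fingroup all_solvable.

(** Write Z = Z(G), H = G', n = |H/Z| = |H : H ∩ Z| and r for the rank of
    H/Z.  The bound is obtained by cutting G down to a subgroup C with
    [C, G] <= Z, hence C <= Z_2(G), by imposing conditions of the form
    << c commutes with w modulo Z >>.  When c runs over a subgroup D, the
    conjugates of w under D modulo Z lie in a coset of [D, G]Z/Z, so each
    condition costs a factor at most |[D, G]Z/Z| in the index
    ([leq_index_cent_mod]).

    Imposing this for r generators w of H modulo Z gives a normal subgroup D
    of index at most n^r with [D, H] <= Z.  Then M = [D, G] lies in both D and
    H, so [M, M] <= Z; thus M is nilpotent, and the rest is done one prime p at
    a time, each prime costing at most the 3r-th power of the p-part of n.

    Suppose first that M is a p-group ([pgroup_commutators_in_center]).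
    Because H is generated by commutators and has rank r modulo Z, some r
    commutators [x, y] generate H modulo H', H ∩ Z and p-th powers
    ([ex_generating_commutators]).  Let X be the set of the 2r elements x, y.
    If [C, X] <= Z then the three subgroups lemma gives [X, X, C] = 1, and since
    [h, c] is a p-element that depends multiplicatively on h in H, it follows
    that [H, C] = 1.  Next, M/Z is an abelian p-group of rank at most r, so its
    socle has order at most p^r and r elements of G suffice to detect that an
    element of M is not central: there is a set Y of r elements with
    C_M(Y) <= Z ([ex_separating_set]).  If moreover [C, Y] <= Z, then
    [Y, C, G] = 1 and [G, Y, C] <= [H, C] = 1, so [C, G, Y] = 1, that is,
    [C, G] <= C_M(Y) <= Z.  This used 3r elements.

    In general this applies to G/R with R = O_{p'}(M), and what it says in G is
    that the p-constituents of the commutators [c, g] are central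
    ([pconstt_commutators_in_center]).  The intersection of the subgroups C
    for the various p has index at most n^{3r} in D, and an element all of whose
    p-constituents are central is central. *)

Set Implicit Arguments.
Unset Strict Implicit.
Unset Printing Implicit Defensive.

Local Open Scope group_scope.

(** * Greedy choice and indices of centralisers *)

(** Both selections of elements below proceed by adding elements one by one,
    each decreasing the dimension [mu] of an elementary abelian section. *)
Lemma greedy_set (T : finType) (mu : {set T} -> nat) (P : pred T) (r : nat) :
  (mu set0 <= r)%N ->
  (forall A : {set T}, A \subset P -> mu A != 0%N ->
     exists2 t, P t & (mu (t |: A) < mu A)%N) ->
  exists A : {set T}, [/\ A \subset P, (#|A| <= r)%N & mu A = 0%N].
Proof.
move=> mu0 step.
suff H k : forall A : {set T}, A \subset P -> (mu A <= k)%N -> (#|A| + k <= r)%N ->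
  exists A : {set T}, [/\ A \subset P, (#|A| <= r)%N & mu A = 0%N].
  apply: (H r set0); rewrite ?cards0 //.
  by apply/subsetP=> x; rewrite inE.
elim: k => [|k IH] A sAP.
  by rewrite leqn0 addn0 => /eqP muA leAr; exists A.
have [muA _|/(step A sAP)[t Pt lt_mu] leAk] := eqVneq (mu A) 0%N.
  by exists A; split=> //; apply: leq_trans (leq_addr _ _) _; eassumption.
rewrite addnS -addSn => leAr.
apply: (IH (t |: A)).
- by apply/subsetP=> x /setU1P[->|/(subsetP sAP)].
- by rewrite -ltnS (leq_trans lt_mu).
- apply: leq_trans leAr; rewrite leq_add2r cardsU1 -add1n leq_add2r.
  by case: (t \notin A).
Qed.

Lemma leq_indexg_setI (gT : finGroupType) (G H K : {group gT}) :
  H \subset G -> (#|G : H :&: K| <= #|G : H| * #|G : K|)%N.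
Proof.
move=> sHG; rewrite -(Lagrange_index sHG (subsetIl H K)) leq_mul //.
by rewrite indexgI (subset_leq_card (imsetS _ sHG)).
Qed.

Lemma leq_index_cent (gT : finGroupType) (D : {group gT}) (A : {set gT}) m :
  {in A, forall x, #|D : 'C_D[x]| <= m}%N -> (#|D : 'C_D(A)| <= m ^ #|A|)%N.
Proof.
have [k leAk] := ubnP #|A|; elim: k => // k IH in A leAk *.
have [->|[x Ax]] := set_0Vmem A.
  by rewrite cards0 /centraliser big_set0 setIT indexgg.
move=> bA; rewrite -{1}(setD1K Ax) (cardsD1 x A) Ax expnD expn1.
rewrite centU setIIr cent_set1.
apply: leq_trans (leq_indexg_setI _ _) _ => /=; first exact: subsetIl.
rewrite leq_mul ?bA //; apply: IH => [|y /setD1P[_ /bA] //].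
by move: leAk; rewrite (cardsD1 x A) Ax.
Qed.

(** The conjugates of x under D are of the form x * [x, d]. *)
Lemma leq_index_cent1 (gT : finGroupType) (D G : {group gT}) x :
  x \in G -> (#|D : 'C_D[x]| <= #|[~: D, G]|)%N.
Proof.
move=> Gx; rewrite index_cent1 -(card_lcoset [~: D, G] x) subset_leq_card //.
apply/subsetP=> _ /imsetP[d Dd ->]; rewrite conjg_mulR mem_lcoset mulKg.
by rewrite commGC mem_commg.
Qed.

Definition cent_mod (gT : finGroupType) (D K : {group gT}) (A : {set gT}) :=
  (D :&: coset K @*^-1 'C(A / K))%G.

Lemma commg_cent_mod (gT : finGroupType) (D K : {group gT}) (A : {set gT}) :
  A \subset 'N(K) -> [~: cent_mod D K A, <<A>>] \subset K.
Proof.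
move=> nKA; rewrite -quotient_cents2 ?gen_subG //=; last first.
  by rewrite subIset // subsetIl orbT.
rewrite quotient_gen // cent_gen.
by rewrite (subset_trans (quotientS _ (subsetIr _ _))) // cosetpreK.
Qed.

Lemma leq_index_cent_mod (gT : finGroupType) (G D K : {group gT}) (A : {set gT}) :
  K <| G -> D \subset G -> A \subset G ->
  (#|D : cent_mod D K A| <= #|[~: D, G] / K| ^ #|A|)%N.
Proof.
move=> /andP[sKG nKG] sDG sAG.
have nKD := subset_trans sDG nKG; have nKA := subset_trans sAG nKG.
rewrite -(index_morphim_ker (coset_morphism K) (subsetIl D _)) //=.
rewrite morphim_setIpre /= [X in (_ * X)%N](_ : _ = 1%N) ?muln1; last first.
  apply/eqP; rewrite indexg_eq1 /= setIS //.
  by rewrite kerE morphpreS ?sub1G.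
apply: leq_trans (leq_index_cent (m := #|[~: D, G] / K|) _) _.
  move=> x /(subsetP (quotientS K sAG)) Gx.
  by rewrite quotientR //; apply: leq_index_cent1.
rewrite leq_pexp2l ?cardG_gt0 //; exact: leq_morphim.
Qed.

(** * Rank modulo a normal subgroup *)

(** The rank of HK/K is at most r; phrasing this through subsets of H, not of
    the quotient, makes it pass to the images of H and K in G/R without any
    comparison of (G/R)/(KR/R) with G/KR. *)
Definition rank_mod_le (gT : finGroupType) (H K : {group gT}) (r : nat) :=
  forall L : {group gT}, L \subset H ->
    exists A : {set gT}, [/\ A \subset L, (#|A| <= r)%N & L \subset <<A>> * K].

Lemma rank_mod_le_rk (gT : finGroupType) (H K : {group gT}) :
  H \subset 'N(K) -> rank_mod_le H K (rk (H / (H :&: K))%G).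
Proof.
move=> nKH L sLH; rewrite /rk; case: ex_minnP => r rkP _.
have nIH : H \subset 'N(H :&: K) by rewrite normsI ?normG.
have nIL := subset_trans sLH nIH.
have /existsP[B /andP[leBr /eqP defB]] :
    generated_by (L / (H :&: K))%G r.
  by have /forallP/(_ (L / (H :&: K))%G)/implyP -> := rkP => //=; rewrite quotientS.
(* [L] need not contain [H :&: K], so coset representatives are chosen in [L]. *)
pose f (y : coset_of (H :&: K)) := odflt 1 [pick x in L | coset (H :&: K) x == y].
have fP y : y \in B -> f y \in L /\ coset (H :&: K) (f y) = y.
  move=> By; have /morphimP[x Nx Lx Ey] : y \in L / (H :&: K).
    by rewrite -[L / _]defB mem_gen.
  rewrite /f; case: pickP => [x' /andP[Lx' /eqP //]|/(_ x)].
  by rewrite Lx Ey eqxx.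
have sAL : f @: B \subset L by apply/subsetP=> _ /imsetP[y /fP[Ly _] ->].
exists (f @: B); split=> //; first exact: leq_trans (leq_imset_card _ _) leBr.
have : L / (H :&: K) \subset <<f @: B>> / (H :&: K).
  rewrite -[L / _]defB quotient_gen ?(subset_trans sAL) //; apply: genS.
  apply/subsetP=> y By; have [Ly Ey] := fP y By.
  rewrite -{1}Ey.
  by apply: mem_morphim; [apply: subsetP Ly | apply: imset_f].
have nIA : <<f @: B>> \subset 'N(H :&: K) by rewrite gen_subG (subset_trans sAL).
rewrite quotientSK // -(normC nIA).
by move/subset_trans; apply; rewrite mulgS ?subsetIr.
Qed.

Lemma rank_mod_le_quotient (gT : finGroupType) (r : nat) (H K R : {group gT})
    (K' : {group coset_of R}) :
    H \subset 'N(R) -> K / R \subset K' -> rank_mod_le H K r ->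
  rank_mod_le (H / R) K' r.
Proof.
move=> nRH sKK' rkH L sLH.
pose L0 := (H :&: coset R @*^-1 L)%G.
have defL : L0 / R = L by rewrite /quotient morphim_setIpre; apply/setIidPr.
have [A [sAL leA sLA]] := rkH L0 (subsetIl _ _).
have nRA : A \subset 'N(R) by rewrite (subset_trans sAL) ?(subset_trans (subsetIl _ _)).
exists (A / R); split; first by rewrite -defL quotientS.
  exact: leq_trans (leq_morphim _ _) leA.
rewrite -defL (subset_trans (quotientS R sLA)) //.
by rewrite quotientMl ?gen_subG // quotient_gen // mulgS.
Qed.

(** * Choosing few elements *)

Lemma logn_abelem_gen (gT : finGroupType) (p : nat) (E : {group gT}) (B : {set gT}) :
  p.-abelem E -> E \subset <<B>> -> B \subset E -> (logn p #|E| <= #|B|)%N.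
Proof.
move=> abE sEB sBE; have defE : <<B>> = E.
  by apply/eqP; rewrite eqEsubset gen_subG sBE.
rewrite -(rank_abelem abE) -grank_abelian ?(abelem_abelian abE) // -defE.
exact: grank_min.
Qed.

(** The set X consists of the entries of r commutators spanning
    V = G'/G''(G' ∩ Z)(G')^p, an elementary abelian group of order at most p^r.
    A subgroup S as in the last clause then covers V, and in the p-group G'/S
    the p-th powers lie in the Frattini subgroup, so S is all of G'. *)
Lemma ex_generating_commutators (gT : finGroupType) (p r : nat) (G Z : {group gT}) :
    prime p -> G^`(1) \subset 'N(Z) -> rank_mod_le G^`(1) Z r ->
  exists X : {set gT}, [/\ X \subset G, (#|X| <= 2 * r)%N &
    forall S : {group gT}, S \subset G^`(1) -> G^`(2) \subset S ->
      G^`(1) :&: Z \subset S -> p.-group (G^`(1) / S) ->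
      [~: X, X] \subset S -> G^`(1) \subset S].
Proof.
move=> pr_p nZH rkH; set H := (G^`(1))%G in nZH rkH *.
pose pw := [set u ^+ p | u in H].
pose F := <<H^`(1) :|: (H :&: Z) :|: pw>>%G.
have sFH : F \subset H.
  rewrite gen_subG !subUset der_sub subsetIl /=.
  by apply/subsetP=> _ /imsetP[u Hu ->]; rewrite groupX.
have sH'F : H^`(1) \subset F by rewrite sub_gen // -setUA subsetUl.
have nFH : F <| H by apply: sub_der1_normal.
have abF : p.-abelem (H / F).
  apply/(abelemP pr_p); split; first exact: sub_der1_abelian.
  move=> _ /morphimP[u Nu Hu ->]; rewrite -morphX //= coset_id //.
  by apply/mem_gen/setUP; right; apply: imset_f.
have leF : (logn p #|H : F| <= r)%N.
  (* Generators of H modulo Z generate H modulo F, since H ∩ Z <= F. *)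
  have [A [sAH leAr sHA]] := rkH H (subxx H).
  rewrite -card_quotient ?normal_norm //.
  apply: (leq_trans (logn_abelem_gen (B := A / F) abF _ _)).
  - rewrite -quotient_gen ?(subset_trans sAH) ?normal_norm //.
    apply/subsetP=> _ /morphimP[h Nh Hh ->].
    have /mulsgP[a z Aa Zz Eh] := subsetP sHA h Hh.
    have Ha : a \in H by apply: subsetP Aa; rewrite gen_subG.
    have Fz : z \in F.
      apply/mem_gen/setUP; left; apply/setUP; right; apply/setIP; split=> //.
      by rewrite -[z](mulKg a) -Eh groupM ?groupV.
    rewrite Eh morphM ?(subsetP (normal_norm nFH)) //=; last exact: (subsetP sFH).
    by rewrite (coset_id Fz) mulg1 mem_quotient.
  - exact: quotientS.
  - exact: leq_trans (leq_morphim _ _) leAr.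
pose comms (T : {set gT * gT}) := [set [~ t.1, t.2] | t in T].
pose E T := <<F :|: comms T>>%G.
have sFE T : F \subset E T by rewrite sub_gen ?subsetUl.
have sEH (T : {set gT * gT}) : T \subset setX G G -> E T \subset H.
  move=> sT; rewrite gen_subG subUset sFH; apply/subsetP=> _ /imsetP[[x y] Txy ->] /=.
  by have /setXP[] := subsetP sT _ Txy; apply: mem_commg.
have pF : p.-nat #|H : F|.
  by rewrite -card_quotient ?normal_norm //; apply: abelem_pgroup abF.
have [|T sT muT|T [sT leT muT]] :=
  @greedy_set _ (fun T => logn p #|H : E T|) (mem (setX G G)) r.
- apply: leq_trans leF; apply: dvdn_leq_log => //.
  by apply: indexgS => //; apply: sEH; rewrite sub0set.
- have [t Gt Et] : exists2 t, t \in setX G G & [~ t.1, t.2] \notin E T.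
    apply/exists_inP; rewrite -negb_forall_in; apply: contra muT => /forall_inP allE.
    rewrite (_ : #|H : E T| = 1%N) ?logn1 //; apply/eqP; rewrite indexg_eq1.
    rewrite gen_subG; apply/subsetP=> _ /imset2P[x y Gx Gy ->].
    by apply: (allE (x, y)); rewrite inE Gx.
  exists t => //.
  have sT' : t |: T \subset setX G G by rewrite subUset sub1set Gt; apply: sT.
  have sEE : E T \subset E (t |: T).
    by apply: genS; rewrite setUS ?imsetS ?subsetUr.
  rewrite -(Lagrange_index (sEH _ sT') sEE) lognM ?indexg_gt0 //.
  rewrite -[X in (X < _)%N]addn0 ltn_add2l lt0n; apply: contra Et => /eqP logE.
  have pE : p.-nat #|E (t |: T) : E T|.
    apply: pnat_dvd pF; rewrite -(Lagrange_index (sEH _ sT') (sFE _)).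
    rewrite dvdn_mull //; exact: indexgS.
  have : #|E (t |: T) : E T| == 1%N by rewrite -(part_pnat_id pE) p_part logE.
  rewrite indexg_eq1 => /subsetP; apply.
  by apply/mem_gen/setUP; right; apply: imset_f; apply: setU11.
have sHE : H \subset E T.
  rewrite -indexg_eq1; have sET : E T \subset H by apply: sEH; apply: sT.
  have pE : p.-nat #|H : E T|.
    by apply: pnat_dvd pF; apply: indexgS.
  by rewrite -(part_pnat_id pE) p_part muT.
exists (fst @: T :|: snd @: T); split.
- rewrite subUset; apply/andP; split; apply/subsetP=> _ /imsetP[[x y] /(subsetP sT) Txy ->].
    by have /setXP[] := Txy.
  by have /setXP[] := Txy.
- rewrite mul2n -addnn; apply: leq_trans (leq_card_setU _ _) _.
  by rewrite leq_add // (leq_trans (leq_imset_card _ _)).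
move=> S sSH sH'S sIS pS sXS.
have nSH : S <| H by apply: sub_der1_normal.
have nS := subsetP (normal_norm nSH).
have inS u : u \in H -> u \in S -> u \in coset S @*^-1 'Phi(H / S).
  by move=> Hu Su; rewrite mem_morphpre ?nS //= coset_id.
have sHPhi : H \subset coset S @*^-1 'Phi(H / S).
  apply: subset_trans sHE _; rewrite gen_subG subUset gen_subG !subUset -!andbA.
  apply/and4P; split; apply/subsetP.
  - by move=> u H'u; apply: inS; [apply: subsetP H'u; apply: der_sub | apply: subsetP H'u].
  - by move=> u Iu; apply: inS; [case/setIP: Iu | apply: subsetP Iu].
  - move=> _ /imsetP[u Hu ->]; rewrite mem_morphpre ?nS ?groupX //= morphX ?nS //.
    rewrite (Phi_joing pS) mem_gen // inE -[p in _ ^+ p]expn1 Mho_p_elt ?orbT //.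
      exact: mem_quotient.
    by apply: mem_p_elt pS _; apply: mem_quotient.
  move=> _ /imsetP[[x y] Txy ->] /=; have /setXP[Gx Gy] := subsetP sT _ Txy.
  apply: inS; first exact: mem_commg.
  apply: (subsetP sXS); apply: mem_commg; apply/setUP.
    by left; apply/imsetP; exists (x, y).
  by right; apply/imsetP; exists (x, y).
(* So H/S is equal to its Frattini subgroup, hence trivial. *)
have [Q1|/Phi_proper] := eqVneq (H / S) 1.
  by rewrite -quotient_sub1 ?normal_norm // Q1.
by case/andP=> _ /negP[]; rewrite -['Phi(_)]cosetpreK quotientS.
Qed.

(** An element of M outside Z(G) does not commute with some g, so adding g to Y
    removes it from C_M(Y).  It is enough to do this until C_M(Y)Z/Z meets the
    socle of M/Z trivially, and the socle has order at most p^r. *)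
Lemma ex_separating_set (gT : finGroupType) (p r : nat) (G M : {group gT}) :
    p.-group M -> M \subset G -> [~: M, M] \subset 'Z(G) ->
    rank_mod_le M 'Z(G) r ->
  exists Y : {set gT}, [/\ Y \subset G, (#|Y| <= r)%N & 'C_M(Y) \subset 'Z(G)].
Proof.
set Z := 'Z(G)%G => pM sMG abM rkM.
have nZM : M \subset 'N(Z) by rewrite (subset_trans sMG) ?normal_norm ?center_normal.
have abMZ : abelian (M / Z) by rewrite /abelian quotient_cents2r.
pose V := 'Ohm_1(M / Z)%G.
have abV : p.-abelem V by rewrite Ohm1_abelem ?quotient_pgroup.
have leV : (logn p #|V| <= r)%N.
  (* The rank hypothesis is applied to the preimage L of the socle in M. *)
  pose L := (M :&: coset Z @*^-1 V)%G.
  have defV : L / Z = V.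
    by rewrite /quotient morphim_setIpre; apply/setIidPr; apply: Ohm_sub.
  have [A [sAL leAr sLA]] := rkM L (subsetIl _ _).
  have nZA : A \subset 'N(Z).
    by rewrite (subset_trans sAL) ?(subset_trans _ nZM) ?subsetIl.
  apply: leq_trans (leq_trans (leq_morphim (coset_morphism Z) A) leAr).
  apply: logn_abelem_gen => //; last by rewrite -defV quotientS.
  have nZL : L \subset 'N(Z) by rewrite (subset_trans (subsetIl _ _)).
  rewrite -[gval V]defV -quotient_gen // quotientSK //.
  by rewrite -(normC (_ : <<A>> \subset 'N(Z))) // gen_subG.
have pVI (Y' : {set gT}) : p.-group (V :&: ('C_M(Y') / Z)).
  by apply: pgroupS (abelem_pgroup abV); apply: subsetIl.
have [|Y sY muY|Y [sY leY muY]] :=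
  @greedy_set _ (fun Y => logn p #|V :&: ('C_M(Y) / Z)|) (mem G) r.
- by apply: leq_trans leV; rewrite dvdn_leq_log ?cardSg ?subsetIl.
- have ntI : V :&: ('C_M(Y) / Z) != 1.
    by apply: contra muY => /eqP->; rewrite cards1 logn1.
  have [x /setIP[Vx /morphimP[v Nv CYv Ex]] ntx] := trivgPn _ ntI.
  move: Vx ntx; rewrite {x}Ex /= => Vv ntv.
  have [Mv Yv] := setIP CYv.
  have /negP nZv : v \notin Z by apply: contra ntv => Zv; rewrite coset_id.
  have [g Gg Cg] : exists2 g, g \in G & v \notin 'C[g].
    apply/exists_inP; rewrite -negb_forall_in; apply/negP=> /forall_inP allC.
    case: nZv; rewrite inE (subsetP sMG) //=; apply/centP=> g Gg.
    by apply/commute_sym/cent1P; rewrite cent1C allC.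
  exists g => //.
  have sub : V :&: ('C_M(g |: Y) / Z) \proper V :&: ('C_M(Y) / Z).
    apply/properP; split; first by rewrite setIS ?quotientS ?setIS ?centS ?subsetUr.
    exists (coset Z v); first by rewrite inE Vv mem_quotient.
    apply/negP=> /setIP[_ /morphimP[w Nw /setIP[_ Cw] Ew]].
    case/negP: Cg; have /rcosetP[z Zz ->] : v \in Z :* w.
      by apply/rcoset_kercosetP.
    rewrite groupM //; first by have [_ /centP Cz] := setIP Zz; apply/cent1P/Cz.
    by apply/cent1P/(centP Cw)/setU11.
  rewrite -(Lagrange (proper_sub sub)) lognM ?cardG_gt0 ?indexg_gt0 //.
  rewrite -[X in (X < _)%N]addn0 ltn_add2l lt0n.
  apply: contraL (proper_subn sub) => /eqP logE; rewrite negbK -indexg_eq1.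
  by rewrite -(part_pnat_id (pnat_dvd (dvdn_indexg _ _) (pVI Y))) p_part logE.
have C1 : 'C_M(Y) / Z = 1.
  apply/eqP; rewrite -Ohm1_eq1 -subG1.
  have sCV : 'Ohm_1('C_M(Y) / Z) \subset V :&: ('C_M(Y) / Z).
    by rewrite subsetI Ohm_sub OhmS ?quotientS ?subsetIl.
  apply: subset_trans sCV _; rewrite subG1 trivg_card1.
  by rewrite -(part_pnat_id (pVI Y)) p_part muY.
exists Y; split=> //.
have sCN : 'C_M(Y) \subset 'N(Z) by rewrite (subset_trans (subsetIl _ _)).
have: 'C_M(Y) / Z \subset [1] by rewrite C1.
by rewrite quotient_sub1.
Qed.

(** * The bound for one prime *)

(** C centralises X and Y modulo Z(G).  The set X serves to make C centralise
    G' outright; this is what makes Y effective, since [G, Y, C] = 1 is one of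
    the two hypotheses of the three subgroups lemma that yields
    [C, G, Y] = 1. *)
Lemma pgroup_commutators_in_center (gT : finGroupType) (p r : nat) (G D : {group gT}) :
    prime p -> D <| G -> [~: D, G^`(1)] \subset 'Z(G) -> p.-group [~: D, G] ->
    rank_mod_le G^`(1) 'Z(G) r ->
  exists C : {group gT}, [/\ C \subset D,
    (#|D : C| <= #|[~: D, G] / 'Z(G)| ^ (3 * r))%N & [~: C, G] \subset 'Z(G)].
Proof.
move=> pr_p /andP[sDG nDG] cDH pM rkH.
set Z := 'Z(G)%G; set H := (G^`(1))%G in cDH rkH.
have [sZG nZG] := andP (center_normal G).
pose M := [~: D, G]%G.
have sMH : M \subset H by apply: commSg.
have sMD : M \subset D by rewrite commg_subl.
have sHG : H \subset G := der_sub 1 G.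
have abM : [~: M, M] \subset Z by apply: subset_trans cDH; apply: commgSS.
have rkM : rank_mod_le M Z r.
  by move=> L sLM; apply: rkH; apply: subset_trans sLM sMH.
have [X [sXG leX genX]] := ex_generating_commutators pr_p (subset_trans sHG nZG) rkH.
have [Y [sYG leY sepY]] := ex_separating_set pM (subset_trans sMH sHG) abM rkM.
have sWG : X :|: Y \subset G by rewrite subUset sXG.
pose C := cent_mod D Z (X :|: Y).
have sCD : C \subset D by apply: subsetIl.
have sCG := subset_trans sCD sDG.
have cCW : [~: C, <<X :|: Y>>] \subset Z.
  exact: commg_cent_mod (subset_trans sWG nZG).
have cZ (A B L : {set gT}) : [~: A, B] \subset Z -> L \subset G -> [~: A, B, L] = 1.
  move=> sAB sLG; apply/commG1P; apply: subset_trans sAB _.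
  by rewrite (subset_trans (subsetIr _ _)) ?centS.
have cCX : [~: C, <<X>>] \subset Z.
  by apply: subset_trans cCW; rewrite commgS ?genS ?subsetUl.
have cCY : [~: C, <<Y>>] \subset Z.
  by apply: subset_trans cCW; rewrite commgS ?genS ?subsetUr.
have sX'G : <<X>> \subset G by rewrite gen_subG.
have sY'G : <<Y>> \subset G by rewrite gen_subG.
have cCH : [~: C, H] \subset Z by apply: subset_trans cDH; apply: commSg.
pose S := 'C_H(C)%G.
have H1 : [~: H, C] = 1.
  apply/commG1P; suffices: H \subset S by rewrite subsetI => /andP[].
  apply: genX.
  - exact: subsetIl.
  - rewrite dergSn; apply/subsetIP; split; first exact: (der_sub 1 H).
    by apply/commG1P; apply: three_subgroup; apply: cZ => //; rewrite commGC.
  - by rewrite setIS // (subset_trans (subsetIr _ _)) ?centS.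
  (* For h in H and c in C, [h, c] is a central element of the p-group M, so
     [h^|M|, c] = [h, c]^|M| = 1 and h has p-power order modulo S. *)
  - apply/pgroupP=> q pr_q /(Cauchy pr_q)[_ /morphimP[h Nh Hh ->] oq].
    have Sh : h ^+ #|M| \in S.
      rewrite inE groupX //; apply/centP=> c Cc; apply/commgP.
      have Mhc : [~ h, c] \in M.
        by rewrite /= commGC mem_commg ?(subsetP sHG) ?(subsetP sCD).
      have /setIP[_ /centP chc] : [~ h, c] \in Z.
        by rewrite (subsetP cCH) // commGC mem_commg.
      rewrite commXg; last by apply/commute_sym/chc/(subsetP sHG).
      by apply/eqP/expg_cardG.
    apply: (pnatPpi pM); rewrite mem_primes pr_q cardG_gt0 -oq order_dvdn.
    by rewrite -morphX //= coset_id.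
  - apply/subsetIP; split; first exact: commgSS.
    apply/commG1P/trivgP; apply: (@subset_trans _ _ [~: <<X>>, <<X>>, C]).
      by rewrite commSg // commgSS // subset_gen.
    by apply/trivgP/three_subgroup; apply: cZ => //; rewrite commGC.
exists C; split=> //.
- apply: leq_trans (leq_index_cent_mod (center_normal G) sDG sWG) _.
  rewrite leq_pexp2l ?cardG_gt0 // (leq_trans (leq_card_setU _ _)) //.
  by rewrite (mulnDl 2%N 1%N) mul1n leq_add.
have CGY : [~: C, G, <<Y>>] = 1.
  apply: three_subgroup; last by apply: cZ => //; rewrite commGC.
  by apply/trivgP; rewrite -H1 commSg //; apply: commgS.
apply: subset_trans sepY; apply/subsetIP; split; first exact: commSg.
by rewrite -(cent_gen Y); apply/commG1P.
Qed.

(** The p'-core R of M = [D, G] is factored out so that the image of M becomes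
    a p-group.  An element of O_p(M) that is central modulo R is central,
    because its commutators with G lie in both O_p(M) and R. *)
Lemma pconstt_commutators_in_center (gT : finGroupType) (p r : nat) (G D : {group gT}) :
    D <| G -> [~: D, G^`(1)] \subset 'Z(G) -> rank_mod_le G^`(1) 'Z(G) r ->
  exists C : {group gT}, [/\ C \subset D,
    (#|D : C| <= #|G^`(1) / 'Z(G)|`_p ^ (3 * r))%N
    & {in C, forall c, {in G, forall g, [~ c, g].`_p \in 'Z(G)}}].
Proof.
move=> nsDG cDH rkH; have [sDG nDG] := andP nsDG.
(* If p is not prime, p-constituents are trivial and D itself will do. *)
have [pr_p|npr_p] := boolP (prime p); last first.
  exists D; split=> //; first by rewrite indexgg expn_gt0 part_gt0.
  move=> c Dc g Gg; rewrite (_ : _.`_p = 1) ?group1 //; apply/constt1P.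
  apply/pnatP=> // q pr_q _; rewrite !inE; apply: contraNneq npr_p => <-.
  exact: pr_q.
have [sZG nZG] := andP (center_normal G).
pose M := [~: D, G]%G.
have sMH : M \subset G^`(1) by apply: commSg.
have sMD : M \subset D by rewrite commg_subl.
have nsMG : M <| G.
  rewrite /normal (subset_trans sMD) //; exact: normsR.
have abM : [~: M, M] \subset 'Z(G) by apply: subset_trans cDH; apply: commgSS.
have nilM : nilpotent M.
  rewrite -quotient_center_nil abelian_nil // sub_der1_abelian //.
  rewrite subsetI der_sub (subset_trans abM) // (subset_trans (subsetIr _ _)) //.
  by rewrite centS ?normal_sub.
pose R := 'O_p^'(M)%G.
have nsRG : R <| G := gFnormal_trans _ nsMG.
have [sRG nRG] := andP nsRG.
have nRD := subset_trans sDG nRG.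
have sZR : 'Z(G) / R \subset 'Z(G / R).
  rewrite subsetI quotientS //= quotient_cents //; exact: subsetIr.
have defMR : [~: D / R, G / R] = M / R by rewrite quotientR.
have pMR : p.-group (M / R).
  rewrite -[gval M](dprodW (nilpotent_pcoreC p nilM)) quotientMidr.
  by rewrite quotient_pgroup ?pcore_pgroup.
have [||||Cb [sCD leC cCG]] := @pgroup_commutators_in_center _ p r (G / R)%G (D / R)%G pr_p.
- exact: quotient_normal.
- rewrite -quotient_der // -quotientR ?(subset_trans (der_sub 1 G)) //.
  by rewrite (subset_trans _ sZR) ?quotientS.
- by rewrite /= defMR.
- rewrite (_ : (G / R)^`(1) = G^`(1) / R)%G; last first.
    by apply/val_inj; rewrite /= quotient_der.
  apply: rank_mod_le_quotient sZR rkH.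
  exact: subset_trans (der_sub 1 G) nRG.
pose C := (D :&: coset R @*^-1 Cb)%G.
have defC : C / R = Cb by rewrite /quotient morphim_setIpre; apply/setIidPr.
exists C; split; first exact: subsetIl.
- have -> : #|D : C| = #|(D / R)%G : Cb|.
    rewrite -defC /= -(index_quotient_eq (H := R) (K := C)) ?subsetIl //=.
    by rewrite setIS // -{1}(ker_coset R) kerE morphpreS ?sub1G.
  apply: leq_trans leC _.
  suff leMn : (#|[~: D / R, G / R] / 'Z(G / R)| <= #|G^`(1) / 'Z(G)|`_p)%N.
    by case: (3 * r)%N => // k; rewrite leq_exp2r.
  (* The order of M/R modulo Z(G/R) is a power of p dividing that of M/Z(G). *)
  rewrite defMR dvdn_leq ?part_gt0 // -(part_pnat_id (quotient_pgroup _ pMR)).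
  apply: partn_dvd; first exact: cardG_gt0.
  apply: dvdn_trans (cardSg (quotientS 'Z(G) sMH)).
  have nZM := subset_trans (normal_sub nsMG) nZG.
  have nZMR : M / R \subset 'N('Z(G / R)).
    by rewrite (subset_trans (quotientS _ (normal_sub nsMG))) ?normal_norm ?center_normal.
  rewrite !card_quotient // -(indexgI M) -(indexgI (M / R)%G).
  apply: dvdn_trans (indexgS _ _) (index_quotient (_ : M :&: (M :&: 'Z(G)) \subset 'N(R))).
    rewrite subsetI quotientS ?subsetIl //=.
    by rewrite (subset_trans (quotientS _ (subsetIr _ _))).
  by rewrite (subset_trans (subsetIl _ _)) ?(subset_trans (normal_sub nsMG)).
move=> c Cc g Gg; set a := [~ c, g].
have [Dc Nc Cbc] : [/\ c \in D, c \in 'N(R) & coset R c \in Cb].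
  by have /setIP[Dc /morphpreP[]] := Cc.
have Ma : a \in M by apply: mem_commg.
have Ng : g \in 'N(R) by apply: (subsetP nRG).
have Za : coset R a \in 'Z(G / R).
  by rewrite /a morphR //= (subsetP cCG) // mem_commg // mem_quotient.
have Oap : a.`_p \in 'O_p(M).
  by rewrite (mem_normal_Hall (nilpotent_pcore_Hall p nilM)) ?pcore_normal ?p_elt_constt // groupX.
have sOM : 'O_p(M) \subset M := pcore_sub p M.
rewrite inE (subsetP (normal_sub nsMG)) ?(subsetP sOM) //=; apply/centP=> y Gy.
have Ny := subsetP nRG y Gy.
have Nap : a.`_p \in 'N(R) by rewrite (subsetP nRG) ?(subsetP (normal_sub nsMG)) ?(subsetP sOM).
have Rapy : [~ a.`_p, y] \in R.
  apply: coset_idr; first exact: groupR.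
  rewrite morphR //=; apply/eqP/commgP.
  have /cycleP[k ->] := cycle_constt p a.
  have Na : a \in 'N(R) by apply: groupR.
  rewrite morphX //=; apply/commute_sym/commuteX/commute_sym.
  by have /setIP[_ /centP] := Za; apply; apply: mem_quotient.
have Oapy : [~ a.`_p, y] \in 'O_p(M).
  have nOG : G \subset 'N('O_p(M)) by rewrite normal_norm ?gFnormal_trans.
  by rewrite commgEl groupM ?groupV ?memJ_norm ?(subsetP nOG).
apply/commgP/eqP/set1gP; rewrite -(coprime_TIg (coprime_pcoreC p M M)).
by rewrite inE Oapy.
Qed.

(** * Combining the primes *)

Lemma leq_index_common_subgroup (gT : finGroupType) (D : {group gT}) (I : eqType)
    (m : I -> nat) (Q : I -> gT -> Prop) :
    (forall i, exists C : {group gT},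
       [/\ C \subset D, (#|D : C| <= m i)%N & {in C, forall x, Q i x}]) ->
  forall s : seq I, exists C : {group gT},
    [/\ C \subset D, (#|D : C| <= \prod_(i <- s) m i)%N
      & {in C, forall x, {in s, forall i, Q i x}}].
Proof.
move=> exC; elim=> [|i s [C [sCD leC QC]]].
  by exists D; rewrite indexgg big_nil; split.
have [B [sBD leB QB]] := exC i.
exists (B :&: C)%G; split; first by rewrite subIset ?sBD.
  rewrite big_cons (leq_trans (leq_indexg_setI _ sBD)) //; exact: leq_mul.
move=> x /setIP[Bx Cx] j; rewrite inE => /predU1P[->|sj]; first exact: QB.
exact: QC.
Qed.

Theorem theorem3 (gT : finGroupType) (G : {group gT}) (r : nat)
    (hr : r = rk (G^`(1) / (G^`(1) :&: 'Z(G)))%G) :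
  (#|G : 'Z_2(G)| <= #|(G^`(1) / (G^`(1) :&: 'Z(G)))%g| ^ (4 * r))%N.
Proof.
have [sZG nZG] := andP (center_normal G).
have sHG := der_sub 1 G.
have nZH := subset_trans sHG nZG.
have rkH : rank_mod_le G^`(1) 'Z(G) r by rewrite hr; apply: rank_mod_le_rk.
have -> : #|G^`(1) / (G^`(1) :&: 'Z(G))| = #|G^`(1) / 'Z(G)|.
  by rewrite !card_quotient ?indexgI // normsI ?normG.
set n := #|G^`(1) / 'Z(G)|; have n_gt0 : (0 < n)%N := cardG_gt0 _.
pose D := cent_mod G 'Z(G) G^`(1).
have sDG : D \subset G := subsetIl _ _.
have nsDG : D <| G.
  rewrite /normal sDG normsI ?normG //.
  rewrite norm_quotient_pre // norms_cent // quotient_norms //.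
  exact: gFnorm.
have cDH : [~: D, G^`(1)] \subset 'Z(G).
  by have := commg_cent_mod G nZH; rewrite genGid.
(* Only r generators of G' modulo Z(G) need be centralised to get D. *)
have leD : (#|G : D| <= n ^ r)%N.
  have [A [sAH leA sHA]] := rkH _ (subxx _).
  have nZA := subset_trans sAH nZH.
  have defH : G^`(1) / 'Z(G) = <<A / 'Z(G)>>.
    apply/eqP; rewrite eqEsubset gen_subG quotientS // andbT.
    rewrite -quotient_gen // quotientSK // -(normC (_ : <<A>> \subset 'N('Z(G)))) //.
    by rewrite gen_subG.
  have -> : D = cent_mod G 'Z(G) A.
    by apply/val_inj; rewrite /= defH cent_gen.
  have sAG := subset_trans sAH sHG.
  apply: leq_trans (leq_index_cent_mod (center_normal G) (subxx _) sAG) _.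
  by rewrite leq_pexp2l.
have [C [sCD leC QC]] := leq_index_common_subgroup
  (fun p => pconstt_commutators_in_center p nsDG cDH rkH) (index_iota 0 #|G|.+1).
have sCZ : C \subset 'Z_2(G).
  apply/subsetP=> c Cc; have Gc : c \in G by rewrite (subsetP sDG) ?(subsetP sCD).
  rewrite ucnSnR ucn1 inE Gc gen_subG.
  apply/subsetP=> _ /imset2P[_ g /set1P-> Gg ->].
  rewrite -(prod_constt [~ c, g]) big_nat_cond.
  apply: group_prod => p /andP[/andP[_ lep] _]; apply: QC => //.
  rewrite mem_index_iota /= (leq_trans lep) // ltnS.
  rewrite dvdn_leq ?cardG_gt0 // order_dvdG // groupR //.
have leCn : (#|D : C| <= n ^ (3 * r))%N.
  apply: leq_trans leC _.
  rewrite -(big_morph (expn^~ (3 * r)%N) (fun a b => expnMn a b _) (exp1n _)).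
  have len : (n <= #|G|)%N.
    by rewrite (leq_trans (leq_morphim _ _)) ?subset_leq_card.
  rewrite [X in (X ^ _ <= _)%N](_ : _ = n) //.
  rewrite -[RHS](partnT n_gt0) (widen_partn _ len).
  by apply: eq_bigr => p _; rewrite p_part.
apply: leq_trans (_ : #|G : C| <= _)%N.
  by rewrite dvdn_leq ?indexg_gt0 // indexgS.
rewrite -(Lagrange_index sDG sCD) (mulnDl 1%N 3%N) mul1n expnD.
exact: leq_mul.
Qed.
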